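(* Let $(u_n)_{n\geq 0}$ be a non-degenerate Lucas sequence, $u_n=a_1u_{n-1}+a_2u_{n-2}$, with non-zero discriminant $\Delta_u=a_1^2+4a_2$. Let $L_u$ be the multiplicative function such that $L_u(p^{k})=\ell_u(p^{k})$ for every prime $p\nmid a_2$ and every $k\geq 1$, and $L_u(p^{k})=p^{k}$ for every prime $p\mid a_2$ and every $k\geq 1$. Then $$\sum_{n>x}\frac{1}{L_u(n)}\ll_u x^{-1/3+\varepsilon},$$ for every $\varepsilon>0$, when $x$ is sufficiently large with respect to $\varepsilon$.
   Context: A Lucas sequence is a sequence of integers $(u_n)_{n\geq 0}$ with $u_0=0$, $u_1=1$ and $u_n=a_1u_{n-1}+a_2u_{n-2}$ for all $n\geq 2$, where $a_1,a_2\in\mathbb{Z}$ and $a_2\neq 0$. It is non-degenerate if no ratio $\alpha_i/\alpha_j$ ($i\neq j$) of pairwise distinct complex roots of the characteristic polynomial $X^2-a_1X-a_2$ is a root of unity. For each positive integer $m$ with $\gcd(m,a_2)=1$, the rank of appearance $z_u(m)$ is the smallest positive integer $n$ such that $m$ divides $u_n$ (it is well known to exist), and $\ell_u(m):=\operatorname{lcm}(m,z_u(m))$. Multiplicative means $L_u(1)=1$ and $L_u(mn)=L_u(m)L_u(n)$ whenever $\gcd(m,n)=1$. The notation $f(x)\ll_u g(x)$ means that there is a constant $c>0$, depending on the sequence $u$, such that $|f(x)|\leq c\,g(x)$ for $x$ sufficiently large. *)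

(* Defs.v *)
From HB Require Import structures.
From mathcomp Require Import all_boot all_order all_algebra.
From mathcomp Require Import complex.
From mathcomp Require Import all_classical all_reals all_analysis.

Set Implicit Arguments.
Unset Strict Implicit.
Unset Printing Implicit Defensive.

Import Order.TTheory GRing.Theory Num.Theory.

Local Open Scope ring_scope.

Definition lucas_sequence (a1 a2 : int) (u : nat -> int) : Prop :=
  [/\ a2 != 0, u 0%N = 0, u 1%N = 1
    & forall n : nat, u n.+2 = a1 * u n.+1 + a2 * u n].

Definition lucas_poly (K : nzRingType) (a1 a2 : int) : {poly K} :=
  'X^2 - (a1%:~R)%:P * 'X - (a2%:~R)%:P.

Definition nondegenerate_lucas (R : realType) (a1 a2 : int) : Prop :=
  forall alpha beta : complex R,
    root (lucas_poly (complex R) a1 a2) alpha ->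
    root (lucas_poly (complex R) a1 a2) beta ->
    alpha != beta ->
    forall n : nat, (0 < n)%N -> ~~ n.-unity_root (alpha / beta).

(* The value is the junk 0 when [m] divides no [u n] with [n] positive; this
   does not happen for a Lucas sequence and [m] positive and coprime to [a2]. *)
Definition rank_of_appearance (u : nat -> int) (m : nat) : nat :=
  if pselect (exists n : nat, (0 < n)%N && (m %| u n)%Z) is left ex
  then ex_minn ex else 0%N.

Definition ell (u : nat -> int) (m : nat) : nat :=
  lcmn m (rank_of_appearance u m).

(* Arithmetic functions live on the positive integers: [L 0] is irrelevant. *)
Definition multiplicative_fun (L : nat -> nat) : Prop :=
  L 1%N = 1%N /\
  forall m n : nat, (0 < m)%N -> (0 < n)%N -> coprime m n ->
    L (m * n)%N = (L m * L n)%N.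

(* As the terms are nonnegative, the sum always makes sense in [\bar R]; it is
   [+oo] exactly when the series diverges. *)
Definition tail_sum (R : realType) (L : nat -> nat) (x : R) : \bar R :=
  (\sum_(0 <= n <oo | (x < n%:R)%R) ((L n)%:R^-1)%:E)%E.

(* Main.v *)
Require Import Defs.
From HB Require Import structures.
From mathcomp Require Import all_boot all_order all_algebra.
From mathcomp Require Import complex.
From mathcomp Require Import all_classical all_reals all_analysis.
From mathcomp Require Import ring lra zify.

Set Implicit Arguments.
Unset Strict Implicit.
Unset Printing Implicit Defensive.

Import Order.TTheory GRing.Theory Num.Theory.

Local Open Scope ring_scope.

(** The argument is Rankin's method with exponent 1/3, and it needs no loss of
    epsilon.  For x >= 1 the tail is at most x^(-1/3) times the sum of
    n^(1/3) / L(n), so it suffices to bound the partial sums of this series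
    ([rankin_sum_le]).  The general term is multiplicative, so the sum over
    n <= N is at most the product over primes p <= N of
    1 + sum_k p^(k/3) / L(p^k) ([sum_le_euler_product]), which is at most the
    exponential of the sum of p^(k/3) / L(p^k) over p and k.

    Let z(p) be the rank of appearance and D the discriminant.  For p not
    dividing 2 a2 D one has L(p^k) >= p^k z(p) ([ell_pfactor_ge]), because p
    does not divide z(p).  The latter follows from the congruence
    u_(mp) = u_m^p u_p modulo p with u_p = D^((p-1)/2), obtained from the
    Frobenius map on the powers of the companion matrix.  Hence the geometric
    series over k is O(p^(-2/3) / z(p)), and it remains to bound the sum of
    these quantities over p, the other primes being finitely many.

    The primes with p <= z(p)^2 contribute O(sum of p^(-7/6)).  The primes with
    z(p) = n and p > n^2 divide u_n, which is nonzero by non-degeneracy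
    ([lucas_neq0]) and at most exponential in n ([lucas_growth]).  So there are
    O(n) of them ([count_primes_dvd]), each contributing at most
    O(n^(-4/3) / n), and the sum over n of n^(-4/3) converges. *)

(** * Lucas sequences modulo a prime *)

Section LucasFrobenius.
Variables (a1 a2 : int) (u : nat -> int).
Hypothesis hu : lucas_sequence a1 a2 u.

(** The matrix [[a1, a2], [1, 0]], a root of X^2 - a1 X - a2.  Its lower-left
    entry is 1 and that of a scalar matrix is 0, so reading this entry off a
    combination of the matrix and the identity gives the first coefficient. *)
Definition lucas_mx (K : nzRingType) : 'M[K]_2 :=
  \matrix_(i, j) (if i == 0 then (if j == 0 then a1%:~R else a2%:~R)
                  else (j == 0)%:R).

Lemma mulintmxE (K : nzRingType) (z : int) (A : 'M[K]_2) i j :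
  (z%:~R * A) i j = z%:~R * A i j.
Proof. by rewrite -(rmorph_int (@scalar_mx K 2)) -mulmxE mul_scalar_mx mxE. Qed.

Lemma addmx2E (K : nzRingType) (A B : 'M[K]_2) i j : (A + B) i j = A i j + B i j.
Proof. by rewrite mxE. Qed.

Lemma scalar_int10 (K : nzRingType) (z : int) : (z%:~R : 'M[K]_2) 1 0 = 0.
Proof. by rewrite -(rmorph_int (@scalar_mx K 2)) mxE. Qed.

Lemma lucas_mx_10 (K : nzRingType) : lucas_mx K 1 0 = 1.
Proof. by rewrite mxE. Qed.

Lemma lucas_mx_sqr (K : comNzRingType) :
  lucas_mx K * lucas_mx K = a1%:~R * lucas_mx K + a2%:~R.
Proof.
rewrite -!(rmorph_int (@scalar_mx K 2)) -!mulmxE !mul_scalar_mx.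
apply/matrixP => i j; rewrite !mxE !big_ord_recl big_ord0 !mxE /=.
case: i => [[|[|//]] Hi]; case: j => [[|[|//]] Hj] /=; ring.
Qed.

Lemma lucas_mx_exp (K : comNzRingType) n :
  lucas_mx K ^+ n.+1 = (u n.+1)%:~R * lucas_mx K + (a2 * u n)%:~R.
Proof.
case: hu => _ u0 u1 uS; elim: n => [|n IH].
  by rewrite u0 u1 mulr0 addr0 mul1r expr1.
rewrite exprSr IH mulrDl -mulrA lucas_mx_sqr uS mulrDr mulrA -addrA.
rewrite [_ + (a2 * u n)%:~R * _]addrC addrA -intrM -mulrDl -intrD -intrM.
by rewrite [u n.+1 * a1]mulrC [u n.+1 * a2]mulrC.
Qed.

Lemma lucas_mx_exp_10 (K : comNzRingType) n : (lucas_mx K ^+ n) 1 0 = (u n)%:~R.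
Proof.
case: n => [|n]; first by case: hu => _ -> _ _; rewrite expr0 mxE.
by rewrite lucas_mx_exp addmx2E mulintmxE lucas_mx_10 scalar_int10 mulr1 addr0.
Qed.

Lemma pchar_mx2 p : prime p -> p \in [pchar 'M['F_p]_2].
Proof.
move=> pp; rewrite inE pp /=.
by rewrite -(rmorph_nat (@scalar_mx 'F_p 2)) pchar_Fp_0 // raddf0.
Qed.

(** Integers are central in every ring, so the Frobenius identity applies
    although the ring need not be commutative. *)
Lemma Frobenius_lin p (K : nzRingType) (A : K) (b c : int) :
  p \in [pchar K] ->
  (b%:~R * A + c%:~R) ^+ p = (b ^+ p)%:~R * A ^+ p + (c ^+ p)%:~R.
Proof.
move=> pK; rewrite -!(pFrobenius_autE pK) pFrobenius_autD_comm; last first.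
  exact: commr_int.
rewrite pFrobenius_autM_comm; last by apply: commr_sym; exact: commr_int.
by rewrite !pFrobenius_autE !rmorphXn.
Qed.

(** Raise M^m = u_m M + c to the power p and compare coefficients of M. *)
Lemma lucas_mulp p m : prime p ->
  (u (m * p))%:~R = (u m)%:~R ^+ p * (u p)%:~R :> 'F_p.
Proof.
move=> pp; have p0 := prime_gt0 pp.
case: m => [|m].
  by case: hu => _ u0 _ _; rewrite mul0n u0 expr0n eqn0Ngt p0 mul0r.
rewrite -lucas_mx_exp_10 exprM lucas_mx_exp Frobenius_lin ?pchar_mx2 //.
by rewrite addmx2E mulintmxE lucas_mx_exp_10 scalar_int10 addr0 rmorphXn.
Qed.

Lemma lucas_mx_disc (K : comNzRingType) :
  (2%:~R * lucas_mx K + (- a1)%:~R) ^+ 2 = (a1 ^+ 2 + 4 * a2)%:~R.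
Proof.
rewrite expr2 -!(rmorph_int (@scalar_mx K 2)) -!mulmxE !mul_scalar_mx.
apply/matrixP => i j; rewrite !mxE !big_ord_recl big_ord0 !mxE /=.
case: i => [[|[|//]] Hi]; case: j => [[|[|//]] Hj] /=;
  rewrite ?mulr0n ?mulr1n !rmorphD ?rmorphN ?rmorphM /=; ring.
Qed.

(** As 2M - a1 is a square root of the discriminant D, comparing its power p
    computed in two ways gives u_p = D^((p-1)/2) modulo p. *)
Lemma lucas_p_neq0 p : prime p -> ~~ (p %| 2 * (a1 ^+ 2 + 4 * a2))%Z ->
  (u p)%:~R != 0 :> 'F_p.
Proof.
move=> pp; rewrite (dvdz_pcharf (pchar_Fp pp)) intrM mulf_eq0 negb_or.
move=> /andP[n2 nD].
have p2 : odd p.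
  case: (even_prime pp) => // p2; move: n2.
  by rewrite -(dvdz_pcharf (pchar_Fp pp)) p2.
have := Frobenius_lin (lucas_mx 'F_p) 2 (- a1) (pchar_mx2 pp).
have -> : ((2%:~R * lucas_mx 'F_p + (- a1)%:~R) ^+ p) =
   ((a1 ^+ 2 + 4 * a2) ^+ p./2)%:~R * (2%:~R * lucas_mx 'F_p + (- a1)%:~R).
  have hp : p = (2 * p./2).+1%N by rewrite mul2n -[LHS]odd_double_half p2.
  transitivity ((2%:~R * lucas_mx 'F_p + (- a1)%:~R) ^+ (2 * p./2).+1).
    by rewrite -hp.
  by rewrite exprSr exprM lucas_mx_disc rmorphXn.
move=> /(congr1 (fun A : 'M['F_p]_2 => A 1 0)).
rewrite mulintmxE !addmx2E !mulintmxE !scalar_int10 lucas_mx_10 lucas_mx_exp_10.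
rewrite !addr0 mulr1.
apply: contra_eq_neq => ->; rewrite mulr0 mulf_neq0 // rmorphXn expf_neq0 //.
Qed.

(** In particular p does not divide its own rank of appearance. *)
Lemma lucas_dvd_mulp p m : prime p -> ~~ (p %| 2 * (a1 ^+ 2 + 4 * a2))%Z ->
  (p %| u (m * p)%N)%Z -> (p %| u m)%Z.
Proof.
move=> pp pD; rewrite !(dvdz_pcharf (pchar_Fp pp)) lucas_mulp //.
rewrite mulf_eq0 (negbTE (lucas_p_neq0 pp pD)) orbF expf_eq0.
by case/andP.
Qed.

End LucasFrobenius.

(** * Size and non-vanishing of Lucas sequences *)

Section Growth.
Variables (a1 a2 : int) (u : nat -> int).
Hypothesis hu : lucas_sequence a1 a2 u.

Lemma lucas_growth n : (`|u n| <= (`|a1| + `|a2|).+1 ^ n)%N.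
Proof.
case: hu => a2_neq0 u0 u1 uS.
suff H : (`|u n| <= (`|a1| + `|a2|).+1 ^ n)%N /\
         (`|u n.+1| <= (`|a1| + `|a2|).+1 ^ n.+1)%N by case: H.
elim: n => [|n [IH1 IH2]]; first by rewrite u0 u1 expn1.
split=> //; rewrite uS.
set B := (`|a1| + `|a2|).+1 in IH1 IH2 *.
have B1 : (B ^ n <= B ^ n.+1)%N by rewrite leq_pexp2l.
have h : (`|(a1 * u n.+1 + a2 * u n)%R| <= `|a1| * `|u n.+1| + `|a2| * `|u n|)%N.
  rewrite -!abszM; move: (a1 * _) (a2 * _) => x y.
  lia.
apply: leq_trans h _.
apply: (@leq_trans (`|a1| * B ^ n.+1 + `|a2| * B ^ n.+1)%N).
  by rewrite leq_add // leq_mul // (leq_trans IH1).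
by rewrite -mulnDl (expnS B n.+1) leq_mul2r /B leqnSn orbT.
Qed.

Lemma lucas_binet (F : comNzRingType) (alpha beta : F) :
  alpha + beta = a1%:~R -> alpha * beta = - a2%:~R ->
  forall n, (u n)%:~R * (alpha - beta) = alpha ^+ n - beta ^+ n.
Proof.
case: hu => _ u0 u1 uS hs hp n.
suff H : (u n)%:~R * (alpha - beta) = alpha ^+ n - beta ^+ n /\
   (u n.+1)%:~R * (alpha - beta) = alpha ^+ n.+1 - beta ^+ n.+1 by case: H.
elim: n => [|n [IH1 IH2]].
  by rewrite u0 u1 mul0r mul1r !expr0 !expr1 subrr.
split=> //; rewrite uS intrD !intrM mulrDl -!mulrA IH1 IH2 -hs.
have -> : a2%:~R = - (alpha * beta) by rewrite hp opprK.
rewrite !exprS; ring.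
Qed.

Lemma lucas_neq0 (R : realType) n :
  nondegenerate_lucas R a1 a2 -> a1 ^+ 2 + 4 * a2 != 0 -> (0 < n)%N ->
  u n != 0.
Proof.
move=> nd D0 n0; apply/negP => /eqP un0.
pose d : complex R := sqrtC (a1 ^+ 2 + 4 * a2)%:~R.
have d2 : d ^+ 2 = (a1 ^+ 2 + 4 * a2)%:~R by exact: sqrtCK.
have d0 : d != 0 by rewrite sqrtC_eq0 intr_eq0.
pose alpha := (a1%:~R + d) / 2; pose beta := (a1%:~R - d) / 2.
have ab : alpha - beta = d by rewrite /alpha /beta; field.
have hs : alpha + beta = a1%:~R by rewrite /alpha /beta; field.
have hp : alpha * beta = - a2%:~R.
  have -> : alpha * beta = (a1%:~R ^+ 2 - d ^+ 2) / 4 by rewrite /alpha /beta; field.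
  by rewrite d2 intrD intrM rmorphXn /=; field.
have a20 : (a2%:~R : complex R) != 0 by rewrite intr_eq0; case: hu.
have root_x (x y : complex R) : x + y = a1%:~R -> x * y = - a2%:~R ->
    root (lucas_poly (complex R) a1 a2) x.
  move=> xy1 xy2; rewrite rootE /lucas_poly !hornerE /=.
  have -> : a2%:~R = - (x * y) by rewrite xy2 opprK.
  rewrite -xy1; apply/eqP; ring.
have b0 : beta != 0.
  apply: contraNneq a20 => b0; move: hp; rewrite b0 mulr0 => /eqP.
  by rewrite eq_sym oppr_eq0.
have rb : root (lucas_poly (complex R) a1 a2) beta.
  by apply: (root_x _ alpha); rewrite 1?addrC 1?mulrC.
have anb : alpha != beta by rewrite -subr_eq0 ab.
move/negP: (nd alpha beta (root_x _ _ hs hp) rb anb n n0); apply.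
have /eqP := lucas_binet hs hp n.
rewrite un0 mul0r eq_sym subr_eq0 => /eqP abn.
rewrite unity_rootE expr_div_n abn.
by rewrite divff // expf_neq0.
Qed.

End Growth.

(** * Prime divisors of an integer *)

Lemma prod_primes_dvd (s : seq nat) m :
  uniq s -> all prime s -> all (dvdn^~ m) s -> (\prod_(p <- s) p %| m)%N.
Proof.
elim: s => [|p s IH] /=; first by rewrite big_nil dvd1n.
case/andP=> ps us /andP[pp prs] /andP[pm sm]; rewrite big_cons Gauss_dvd.
  by rewrite pm IH.
rewrite prime_coprime // Euclid_dvd_prod //.
apply/negP; rewrite big_has => /hasP[q qs].
rewrite dvdn_prime2 ?(allP prs q qs) // => /eqP pq.
by rewrite pq qs in ps.
Qed.

(** A product of r distinct primes is at least 2^r, and b <= 2^b. *)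
Lemma count_primes_dvd (s : seq nat) m b n :
  uniq s -> all prime s -> all (dvdn^~ m) s -> (0 < m)%N -> (m <= b ^ n)%N ->
  (size s <= b * n)%N.
Proof.
move=> us ps ds m0 mb.
have h1 : (2 ^ size s <= \prod_(p <- s) p)%N.
  elim: s ps {us ds} => [|p s IH] /=; first by rewrite big_nil.
  case/andP=> pp ps; rewrite big_cons expnS leq_mul ?prime_gt1 //; exact: IH.
rewrite -(@leq_exp2l 2) // (leq_trans h1) //.
apply: leq_trans (dvdn_leq m0 (prod_primes_dvd us ps ds)) _.
apply: leq_trans mb _; rewrite expnM.
case: n => [|n]; first by rewrite !expn0.
by rewrite leq_exp2r // ltnW // ltn_expl.
Qed.

Lemma sum_prime_divisors_le (R : realFieldType) (c : R) m b n N :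
  0 <= c -> (0 < m)%N -> (m <= b ^ n)%N ->
  \sum_(p < N.+1 | prime p) (if (p %| m)%N then c else 0) <= c * (b * n)%:R.
Proof.
move=> c0 m0 mb; rewrite -big_mkcondr sumr_const -[_ *+ _]mulr_natr.
rewrite ler_wpM2l // ler_nat cardE -(size_map val).
apply: (count_primes_dvd _ _ _ m0 mb).
- by rewrite map_inj_uniq ?enum_uniq //; exact: val_inj.
- by apply/allP => _ /mapP[p + ->]; rewrite mem_enum unfold_in => /andP[].
- by apply/allP => _ /mapP[p + ->]; rewrite mem_enum unfold_in => /andP[].
Qed.

(** * Lower bound for ell at prime powers *)

Section Rank.
Variables (a1 a2 : int) (u : nat -> int).
Hypothesis hu : lucas_sequence a1 a2 u.

Lemma rank_of_appearance_dvd (m : nat) :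
  (0 < rank_of_appearance u m)%N -> (m %| u (rank_of_appearance u m))%Z.
Proof.
rewrite /rank_of_appearance; case: pselect => // ex _.
by case: ex_minnP => n /andP[].
Qed.

Lemma rank_of_appearance_bounds (m n : nat) : (0 < n)%N -> (m %| u n)%Z ->
  (0 < rank_of_appearance u m <= n)%N.
Proof.
move=> n0 mn; rewrite /rank_of_appearance; case: pselect => [ex|[]].
  by case: ex_minnP => z /andP[z0 _] zmin; rewrite z0 zmin ?n0.
by exists n; rewrite n0.
Qed.

(** Write the rank z of p^k as p^j m with m prime to p.  By [lucas_dvd_mulp], p
    divides u_m, so m is at least the rank of p, and p^k m divides lcm(p^k, z).  The
    positivity hypothesis sets aside the junk value 0 of the rank. *)
Lemma ell_pfactor_ge p k : prime p -> ~~ (p %| 2 * (a1 ^+ 2 + 4 * a2))%Z ->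
  (0 < k)%N -> (0 < ell u (p ^ k))%N ->
  (0 < rank_of_appearance u p)%N /\
  (p ^ k * rank_of_appearance u p <= ell u (p ^ k))%N.
Proof.
move=> pp pD k0; rewrite /ell lcmn_gt0 => /andP[pk0 z0].
have [m cpm zE] := pfactor_coprime pp z0.
have pk_dvd : (p %| (p ^ k)%N%:Z)%Z by rewrite dvdzE /= dvdn_exp.
have := dvdz_trans pk_dvd (rank_of_appearance_dvd z0).
rewrite zE; set j := logn p _ => pu.
have pm : (p %| u m)%Z.
  elim: j pu => [|j IH]; first by rewrite expn0 muln1.
  by rewrite expnSr mulnA => /(lucas_dvd_mulp hu pp pD).
have m0 : (0 < m)%N by move: z0; rewrite zE muln_gt0 => /andP[].
have /andP[-> zm] := rank_of_appearance_bounds m0 pm; split=> //.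
apply: (@leq_trans (p ^ k * m)); first by rewrite leq_mul2l zm orbT.
rewrite dvdn_leq ?lcmn_gt0 ?pk0 -?zE // Gauss_dvd ?coprimeXl // dvdn_lcml /=.
by rewrite zE (dvdn_trans (dvdn_mulr (p ^ j) (dvdnn m))) // dvdn_lcmr.
Qed.

End Rank.

(** * A finite Euler product inequality *)

Section EulerBound.
Variables (R : realFieldType) (f : nat -> R).
Hypothesis f1 : f 1%N = 1.
Hypothesis fM : forall m n, (0 < m)%N -> (0 < n)%N -> coprime m n ->
  f (m * n)%N = f m * f n.
Hypothesis f_ge0 : forall n, 0 <= f n.

(** Positive integers whose prime divisors are all less than [t]. *)
Definition smooth t n := (0 < n)%N && all (fun p => p < t)%N (primes n).

(** Induction on [t]: at a prime [t], split n as t^k m with m prime to t. *)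
Lemma smooth_sum_le t N :
  \sum_(n < N.+1 | smooth t n) f n <=
  \prod_(p < t | prime p) \sum_(k < N.+1) f (p ^ k)%N.
Proof.
elim: t => [|t IH].
  rewrite big_ord0; case: N => [|N].
    by rewrite big_mkcond big_ord_recl big_ord0 /= addr0 ler01.
  have n1 : (1 < N.+2)%N by [].
  rewrite (big_pred1 (Ordinal n1)) ?f1 // => n /=; rewrite /smooth.
  rewrite -val_eqE /=; case: (nat_of_ord n) => [|[|k]] //=.
  by have := primes_eq0 k.+2; case: (primes k.+2).
have smoothS n : smooth t.+1 n = (0 < n)%N && all (fun p => (p < t) || (p == t))%N (primes n).
  by rewrite /smooth; congr (_ && _); apply: eq_all => p; rewrite ltnS leq_eqVlt orbC.
rewrite [leRHS]big_mkcond big_ord_recr -big_mkcond /=; case: ifP => pt; last first.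
  rewrite mulr1; apply: le_trans IH; rewrite le_eqVlt; apply/orP; left.
  apply/eqP; apply: eq_bigl => n; rewrite smoothS /smooth; congr (_ && _).
  apply: eq_in_all => p; rewrite mem_primes => /and3P[pp _ _].
  by case: eqP => [ptE|]; rewrite ?orbF //; rewrite ptE pt in pp.
rewrite mulrC.
apply: le_trans (ler_wpM2l _ IH); last by apply: sumr_ge0.
rewrite big_distrlr /= pair_big_dep /=.
have part_lt (n : 'I_N.+1) : (0 < n)%N -> (n`_t^' < N.+1)%N.
  by move=> n0; rewrite (leq_ltn_trans (dvdn_leq n0 (dvdn_part _ _))).
have log_lt (n : 'I_N.+1) : (0 < n)%N -> (logn t n < N.+1)%N.
  by move=> n0; rewrite (leq_trans (ltn_logl _ n0)) // ltnW.
pose h (n : 'I_N.+1) : 'I_N.+1 * 'I_N.+1 := (inord (logn t n), inord n`_t^').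
pose G (km : 'I_N.+1 * 'I_N.+1) := f (t ^ km.1)%N * f km.2.
pose A := [set n : 'I_N.+1 | smooth t.+1 n].
have inj : {in A &, injective h}.
  move=> n n'; rewrite !inE => /andP[n0 _] /andP[n0' _] [].
  move=> /(congr1 val); rewrite /= !inordK ?log_lt // => e1.
  move=> /(congr1 val); rewrite /= !inordK ?part_lt // => e2.
  by apply: val_inj => /=; rewrite -(partnC t n0) -(partnC t n0') !p_part e1 e2.
have -> : \sum_(n < N.+1 | smooth t.+1 n) f n = \sum_(n in A) G (h n).
  apply: eq_big => [n|n sn]; first by rewrite inE.
  have n0 : (0 < n)%N by case/andP: sn.
  rewrite /G /= !inordK ?log_lt ?part_lt // -fM ?part_gt0 ?expn_gt0
    ?(prime_gt0 pt) // -p_part ?coprime_partC // ?partnC //.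
rewrite -(big_imset (fun km => G km) inj) /=.
rewrite [leLHS]big_mkcond [leRHS]big_mkcond; apply: ler_sum => -[k m] _ /=.
case: ifP => [/imsetP[n nA [-> ->]]|_]; last by case: ifP => // _; rewrite mulr_ge0.
suff -> : smooth t (inord n`_t^' : 'I_N.+1) by [].
move: nA; rewrite inE smoothS => /andP[n0 /allP sn].
rewrite inordK ?part_lt // /smooth part_gt0 /=.
apply/allP => p; rewrite primes_part mem_filter => /andP[pt' pn].
by move: pt' (sn p pn); rewrite !inE => /negbTE ->; rewrite orbF.
Qed.

Lemma sum_le_euler_product N :
  \sum_(1 <= n < N.+1) f n <=
  \prod_(p < N.+1 | prime p) (1 + \sum_(1 <= k < N.+1) f (p ^ k)%N).
Proof.
have -> : \prod_(p < N.+1 | prime p) (1 + \sum_(1 <= k < N.+1) f (p ^ k)%N) =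
   \prod_(p < N.+1 | prime p) \sum_(k < N.+1) f (p ^ k)%N.
  apply: eq_bigr => p _; rewrite -(big_mkord xpredT (fun k => f (p ^ k)%N)).
  by rewrite big_nat_recl // big_add1 /= f1.
apply: le_trans (smooth_sum_le _ _).
rewrite big_add1 /= big_mkord [leRHS]big_mkcond big_ord_recl /= add0r.
apply: ler_sum => n _; rewrite /smooth /=.
suff -> : all (fun p => p < N.+1)%N (primes n.+1) by [].
apply/allP => p; rewrite mem_primes => /and3P[_ _ /dvdn_leq].
by move=> /(_ isT) /leq_trans; apply; rewrite (leq_trans (ltn_ord n)).
Qed.

End EulerBound.

(** * Sixth roots of integers *)

Section SixthRoots.
Variable R : realType.
(** The real sixth root of a natural number; the exponents 1/3, 2/3 and 7/6 of
    the argument are then integer powers of it. *)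
Definition sixth (n : nat) : R := n%:R `^ 6^-1.

Lemma sixth_exp n : sixth n ^+ 6 = n%:R.
Proof.
by rewrite -powR_mulrn ?powR_ge0 // -powRrM mulVf ?pnatr_eq0 // powRr1.
Qed.

Lemma sixthM m n : sixth (m * n)%N = sixth m * sixth n.
Proof. by rewrite /sixth natrM powRM. Qed.

Lemma sixth1 : sixth 1 = 1.
Proof. by rewrite /sixth powR1. Qed.

Lemma sixthX m k : sixth (m ^ k) = sixth m ^+ k.
Proof.
by elim: k => [|k IH]; rewrite ?expn0 ?sixth1 ?expr0 // expnS sixthM IH exprS.
Qed.

Lemma le_sixth m n : (m <= n)%N -> sixth m <= sixth n.
Proof. by move=> mn; rewrite ge0_ler_powR ?nnegrE ?ler_nat ?invr_ge0. Qed.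

Lemma sixth_ge1 n : (0 < n)%N -> 1 <= sixth n.
Proof. by move=> n0; rewrite -sixth1 le_sixth. Qed.

Lemma sixth_gt0 n : (0 < n)%N -> 0 < sixth n.
Proof. by move=> n0; rewrite (lt_le_trans ltr01) // sixth_ge1. Qed.

Lemma sixth_ge0 n : 0 <= sixth n. Proof. exact: powR_ge0. Qed.

(** The series of n^(-7/6) is dominated by a telescoping one: n^(-7/6) is at
    most 12 (n^(-1/6) - (n+1)^(-1/6)). *)
Lemma sum_inv_sixth N : \sum_(1 <= n < N.+1) (sixth n)^-1 ^+ 7 <= 12.
Proof.
apply: (@le_trans _ _ (\sum_(1 <= n < N.+1)
    (12 * - (sixth n.+1)^-1 - 12 * - (sixth n)^-1))).
  apply: ler_sum_nat => n /andP[n1 _].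
  have s0 := sixth_gt0 n1; have s1 := sixth_ge1 n1.
  have t0 := sixth_gt0 (ltn0Sn n); have st := le_sixth (leqnSn n).
  have := sixth_exp n.+1; rewrite -natr1 -(sixth_exp n).
  move: (sixth n) (sixth n.+1) s0 s1 t0 st => s t s0 s1 t0 st E.
  (* t and s are the sixth roots of n+1 and n. *)
  have S1 : (t - s) * (t ^+ 5 + t ^+ 4 * s + t ^+ 3 * s ^+ 2 + t ^+ 2 * s ^+ 3
      + t * s ^+ 4 + s ^+ 5) = 1.
    have -> : 1 = t ^+ 6 - s ^+ 6 by rewrite E; ring.
    ring.
  have S2 : 1 <= (t - s) * (6 * t ^+ 5).
    rewrite -[leLHS]S1 ler_wpM2l ?subr_ge0 //.
    have e k j : t ^+ k * s ^+ j <= t ^+ k * t ^+ j.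
      by rewrite ler_wpM2l ?exprn_ge0 ?lerXn2r ?nnegrE // ltW.
    have := e 4 1; have := e 3 2; have := e 2 3; have := e 1 4; have := e 0 5.
    lra.
  have s6 : 1 <= s ^+ 6 by rewrite exprn_ege1.
  rewrite -subr_ge0.
  have -> : 12 * - t^-1 - 12 * - s^-1 - s^-1 ^+ 7 =
      (12 * s ^+ 6 * (t - s) - t) / (s ^+ 7 * t).
    by field; rewrite !lt0r_neq0.
  apply: divr_ge0; last by rewrite mulr_ge0 ?exprn_ge0 // ltW.
  rewrite subr_ge0.
  apply: (@le_trans _ _ (t * ((t - s) * (6 * t ^+ 5)))).
    by rewrite -[leLHS]mulr1 ler_wpM2l // ltW.
  have -> : t * ((t - s) * (6 * t ^+ 5)) = 6 * t ^+ 6 * (t - s) by ring.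
  by rewrite ler_wpM2r ?subr_ge0 // E; lra.
rewrite telescope_sumr // sixth1; have := sixth_gt0 (ltn0Sn N).
rewrite -invr_gt0; lra.
Qed.

Lemma geometric_sum_le (r : R) N : 0 <= r -> r <= 2 / 3 ->
  \sum_(1 <= k < N.+1) r ^+ k <= 3 * r.
Proof.
move=> r0 r23; elim: N => [|N IH]; first by rewrite big_geq // mulr_ge0.
rewrite big_nat_recl // expr1.
under eq_bigr => k _ do rewrite exprS.
rewrite -mulr_sumr; have := ler_wpM2l r0 IH; nra.
Qed.

(** That is, p^(-2/3) <= 2/3; cubing reduces it to 1/4 <= 8/27. *)
Lemma inv_sixth4_le p : (1 < p)%N -> (sixth p)^-1 ^+ 4 <= 2 / 3.
Proof.
move=> p1; have q0 := sixth_gt0 (ltnW p1).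
have h : (sixth p)^-1 ^+ 4 ^+ 3 <= (2 / 3) ^+ 3.
  rewrite -exprM (exprM _ 6 2) exprVn sixth_exp exprVn.
  have p2 : (2 : R) <= p%:R by rewrite ler_nat.
  apply: (@le_trans _ _ (2 ^+ 2)^-1); last by lra.
  by rewrite lef_pV2 ?posrE ?exprn_gt0 // ?lerXn2r ?nnegrE //; lra.
by rewrite -(@ler_pXn2r _ 3) ?nnegrE ?exprn_ge0 ?invr_ge0 // ltW.
Qed.

(** The general term n^(1/3) / L(n) of the series in Rankin's method.  It
    vanishes where L(n) = 0. *)
Definition rankin (L : nat -> nat) n : R := sixth n ^+ 2 / (L n)%:R.

(** Compare with the geometric series of ratio p^(-2/3).  The lower bound on L is
    only required where L is positive, as other terms vanish. *)
Lemma sum_rankin_prime_powers_le L p w N : (1 < p)%N -> (0 < w)%N ->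
  (forall k, (0 < k)%N -> (0 < L (p ^ k))%N -> (p ^ k * w <= L (p ^ k))%N) ->
  \sum_(1 <= k < N.+1) rankin L (p ^ k) <= 3 * (sixth p)^-1 ^+ 4 / w%:R.
Proof.
move=> p1 w0 Lge; have p0 := ltnW p1; have q0 := sixth_gt0 p0.
have w0' : 0 < w%:R :> R by rewrite ltr0n.
apply: (@le_trans _ _ ((\sum_(1 <= k < N.+1) (sixth p)^-1 ^+ 4 ^+ k) / w%:R)); last first.
  rewrite ler_pM2r ?invr_gt0 // geometric_sum_le ?inv_sixth4_le //.
  by rewrite exprn_ge0 ?invr_ge0 ?sixth_ge0.
rewrite mulr_suml; apply: ler_sum_nat => k /andP[k0 _].
rewrite /rankin sixthX; case: (posnP (L (p ^ k)%N)) => [->|L0].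
  by rewrite invr0 mulr0 divr_ge0 ?exprn_ge0 ?invr_ge0 ?ler0n ?sixth_ge0.
have -> : (sixth p)^-1 ^+ 4 ^+ k / w%:R = (sixth p ^+ k) ^+ 2 / (p ^ k * w)%:R.
  rewrite natrM natrX -(sixth_exp p) exprAC [_ ^+ 6 ^+ k]exprAC exprVn.
  by field; rewrite lt0r_neq0 // expf_neq0 ?lt0r_neq0.
rewrite ler_wpM2l ?exprn_ge0 ?sixth_ge0 // lef_pV2 ?posrE ?ltr0n ?ler_nat ?Lge //.
by rewrite muln_gt0 expn_gt0 p0.
Qed.

End SixthRoots.


(** * The Rankin sum over prime powers and the tail *)

Section LucasSums.
Variables (R : realType) (a1 a2 : int) (u : nat -> int).
Hypothesis hu : lucas_sequence a1 a2 u.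
Hypothesis hdisc : a1 ^+ 2 + 4 * a2 != 0.
Hypothesis hnz : forall n, (0 < n)%N -> u n != 0.
Variable L : nat -> nat.
Hypothesis hL : multiplicative_fun L.
Hypothesis hLndvd : forall p k : nat, prime p -> ~~ (p %| a2)%Z -> (0 < k)%N ->
       L (p ^ k)%N = ell u (p ^ k)%N.
Hypothesis hLdvd : forall p k : nat, prime p -> (p %| a2)%Z -> (0 < k)%N ->
       L (p ^ k)%N = (p ^ k)%N.

(* A prime is called bad when it divides 2 a2 D, with D the discriminant. *)
Let bad := `|(2 * a2 * (a1 ^+ 2 + 4 * a2))%R|%N.
Let B := (`|a1| + `|a2|).+1.

Lemma L_pfactor_ge p k : prime p -> (0 < k)%N -> (0 < L (p ^ k))%N ->
  (p ^ k <= L (p ^ k))%N.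
Proof.
move=> pp k0; have [pa|pa] := boolP (p %| a2)%Z; first by rewrite hLdvd.
by rewrite hLndvd // => l0; rewrite dvdn_leq // dvdn_lcml.
Qed.

Lemma good_prime p : ~~ (p %| bad)%N ->
  ~~ (p %| a2)%Z /\ ~~ (p %| 2 * (a1 ^+ 2 + 4 * a2))%Z.
Proof.
move=> pb; split; apply: contra pb => pd.
  by suff: (p %| 2 * a2 * (a1 ^+ 2 + 4 * a2))%Z by []; rewrite mulrAC dvdz_mull.
by suff: (p %| 2 * a2 * (a1 ^+ 2 + 4 * a2))%Z by []; rewrite mulrAC dvdz_mulr.
Qed.

(** Let z be the rank of a good prime p.  The Euler factor is O(p^(-2/3) / z),
    which is O(p^(-7/6)) if p <= z^2.  Otherwise it is O(z^(-4/3) / z), and as p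
    divides u_z this is the term n = z of the last sum. *)
Lemma euler_factor_le p N : prime p -> (p <= N)%N ->
  \sum_(1 <= k < N.+1) rankin R L (p ^ k) <=
    (if (p %| bad)%N then 3 else 0) + 3 * (sixth R p)^-1 ^+ 7 +
    \sum_(1 <= n < N.+1) (if (p %| `|u n|)%N then 3 * (sixth R n)^-1 ^+ 8 / n%:R else 0).
Proof.
move=> pp pN; have p1 := prime_gt1 pp; have p0 := ltnW p1.
have q0 := sixth_gt0 R p0; have q1 := sixth_ge1 R p0.
have A0 : 0 <= 3 * (sixth R p)^-1 ^+ 7 by rewrite mulr_ge0 ?exprn_ge0 ?invr_ge0 ?sixth_ge0.
have term_ge0 n : 0 <= (if (p %| `|u n|)%N then 3 * (sixth R n)^-1 ^+ 8 / n%:R else 0).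
  by case: ifP => // _; rewrite divr_ge0 ?mulr_ge0 ?exprn_ge0 ?invr_ge0 ?sixth_ge0.
have S0 : 0 <= \sum_(1 <= n < N.+1) (if (p %| `|u n|)%N then 3 * (sixth R n)^-1 ^+ 8 / n%:R else 0).
  exact: sumr_ge0.
have [pb|pb] := boolP (p %| bad)%N.
  rewrite -addrA; apply: ler_wpDr; first exact: addr_ge0.
  have := @sum_rankin_prime_powers_le R L p 1 N p1 isT; rewrite divr1.
  move=> H; apply: le_trans (H _) _ => [k k0 Lk|].
    by rewrite muln1 L_pfactor_ge.
  by rewrite ler_piMr // exprn_ile1 ?invr_ge0 ?sixth_ge0 // invf_le1.
(* If p has no rank, then L vanishes at the powers of p. *)
rewrite add0r; have [pa2 pD] := good_prime pb.
have [z0|z0] := posnP (rank_of_appearance u p).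
  rewrite big_nat big1 ?addr_ge0 // => k /andP[k0 _].
  rewrite /rankin hLndvd //; have [->|l0] := posnP (ell u (p ^ k)).
    by rewrite invr0 mulr0.
  by have [] := ell_pfactor_ge hu pp pD k0 l0; rewrite z0.
set z := rank_of_appearance u p in z0 *.
have H := @sum_rankin_prime_powers_le R L p z N p1 z0.
apply: le_trans (H _) _ => [k k0|].
  by rewrite hLndvd // => l0; have [] := ell_pfactor_ge hu pp pD k0 l0.
have z0' : 0 < z%:R :> R by rewrite ltr0n.
have [pz|pz] := leqP p (z ^ 2).
  apply: ler_wpDr => //.
  rewrite -mulrA ler_wpM2l // (exprD _ 4 3) ler_wpM2l ?exprn_ge0 ?invr_ge0 ?sixth_ge0 //.
  rewrite exprVn lef_pV2 ?posrE ?exprn_gt0 //.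
  rewrite -(@ler_pXn2r _ 2) ?nnegrE ?exprn_ge0 ?sixth_ge0 //.
  by rewrite -exprM sixth_exp -natrX ler_nat.
have zN : (1 <= z < N.+1)%N.
  by rewrite z0 ltnS (leq_trans _ pN) // (leq_trans _ (ltnW pz)) // leq_pmulr.
apply: ler_wpDl => //.
rewrite (bigD1_seq z) ?mem_index_iota ?iota_uniq //=.
apply: ler_wpDr; first exact: sumr_ge0.
have -> : (p %| `|u z|)%N by exact: (@rank_of_appearance_dvd u p).
rewrite ler_pM2r ?invr_gt0 // ler_wpM2l // (exprM _ 2 4) lerXn2r ?nnegrE //.
- by rewrite invr_ge0 sixth_ge0.
- by rewrite exprn_ge0 // invr_ge0 sixth_ge0.
rewrite exprVn lef_pV2 ?posrE ?exprn_gt0 ?sixth_gt0 //.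
by rewrite -sixthX le_sixth // ltnW.
Qed.

Lemma bad_gt0 : (0 < bad)%N.
Proof. by rewrite absz_gt0 !mulf_neq0 //; case: hu. Qed.

(** At most B n primes divide u_n, so the primes with p > z^2 contribute at most
    the sum over n of (B n) n^(-4/3) / n. *)
Lemma sum_euler_factors_le N :
  \sum_(p < N.+1 | prime p) \sum_(1 <= k < N.+1) rankin R L (p ^ k) <=
  3 * bad%:R + 36 + 36 * B%:R.
Proof.
apply: le_trans.
  by apply: ler_sum => p pp; apply: (euler_factor_le pp); rewrite -ltnS.
rewrite /= !big_split /= -[leLHS]addrA -[leRHS]addrA.
apply: lerD; last apply: lerD.
- have := @sum_prime_divisors_le R 3 bad bad 1 N.
  by rewrite muln1 expn1; apply => //; exact: bad_gt0.
- apply: (@le_trans _ _ (\sum_(1 <= n < N.+1) 3 * (sixth R n)^-1 ^+ 7)).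
    rewrite [leRHS]big_add1 big_mkord big_mkcond big_ord_recl /= add0r.
    apply: ler_sum => n _; rewrite /=; case: ifP => // _.
    by rewrite mulr_ge0 ?exprn_ge0 ?invr_ge0 ?sixth_ge0.
  rewrite -mulr_sumr; have := sum_inv_sixth R N; lra.
- rewrite exchange_big /=.
  apply: (@le_trans _ _ (\sum_(1 <= n < N.+1) 3 * B%:R * (sixth R n)^-1 ^+ 7)).
    apply: ler_sum_nat => n /andP[n0 _].
    have q0 := sixth_ge0 R n; have q1 := sixth_ge1 R n0.
    have c0 : 0 <= 3 * (sixth R n)^-1 ^+ 8 / n%:R.
      by rewrite divr_ge0 ?mulr_ge0 ?exprn_ge0 ?invr_ge0.
    apply: le_trans (@sum_prime_divisors_le R _ _ B n N c0 _ (lucas_growth hu n)) _.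
      by rewrite absz_gt0 hnz.
    rewrite natrM.
    have -> : 3 * (sixth R n)^-1 ^+ 8 / n%:R * (B%:R * n%:R) = 3 * B%:R * (sixth R n)^-1 ^+ 8.
      by field; rewrite pnatr_eq0 -lt0n n0 lt0r_neq0 // sixth_gt0.
    rewrite ler_wpM2l ?mulr_ge0 // exprSr ler_piMr ?exprn_ge0 ?invr_ge0 //.
    by rewrite invf_le1 // sixth_gt0.
  rewrite -mulr_sumr; have := sum_inv_sixth R N.
  have : 0 <= B%:R :> R by [].
  nra.
Qed.

Lemma rankinM m n : (0 < m)%N -> (0 < n)%N -> coprime m n ->
  rankin R L (m * n) = rankin R L m * rankin R L n.
Proof.
move=> m0 n0 mn; rewrite /rankin sixthM exprMn.
by case: hL => _ ->//; rewrite natrM invfM mulrACA.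
Qed.

Lemma rankin_ge0 n : 0 <= rankin R L n.
Proof. by rewrite divr_ge0 ?exprn_ge0 ?sixth_ge0. Qed.

Lemma rankin_sum_le N :
  \sum_(1 <= n < N.+1) rankin R L n <= expR (3 * bad%:R + 36 + 36 * B%:R).
Proof.
have f1 : rankin R L 1 = 1.
  by case: hL => L1 _; rewrite /rankin L1 sixth1 expr1n divr1.
apply: le_trans (sum_le_euler_product f1 rankinM rankin_ge0 N) _.
apply: (@le_trans _ _ (\prod_(p < N.+1 | prime p)
    expR (\sum_(1 <= k < N.+1) rankin R L (p ^ k)))).
  apply: ler_prod => p pp; rewrite expR_ge1Dx andbT addr_ge0 // sumr_ge0 // => k _.
  exact: rankin_ge0.
by rewrite -expR_sum ler_expR sum_euler_factors_le.
Qed.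

Lemma tail_sum_le : exists2 c : R, 0 < c &
  forall x : R, 1 <= x -> (tail_sum L x <= (c * x `^ (- (1 / 3)))%:E)%E.
Proof.
exists (expR (3 * bad%:R + 36 + 36 * B%:R)); first exact: expR_gt0.
move=> x x1; have x0 : 0 < x := lt_le_trans ltr01 x1.
rewrite /tail_sum; apply: lime_le.
  by apply: is_cvg_nneseries_cond => n _ _; rewrite lee_fin invr_ge0.
apply: nearW => N; rewrite sumEFin lee_fin.
apply: (@le_trans _ _ (\sum_(1 <= n < N.+1) rankin R L n * x `^ (- (1 / 3)))); last first.
  by rewrite -mulr_suml ler_wpM2r ?powR_ge0 ?rankin_sum_le.
have inv_ge0 n : 0 <= (if x < n%:R then (L n)%:R^-1 else 0) by case: ifP.
rewrite big_mkcond /=.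
apply: (@le_trans _ _ (\sum_(0 <= n < N.+1) (if x < n%:R then (L n)%:R^-1 else 0))).
  by rewrite big_nat_recr //= ler_wpDr.
rewrite [leLHS]big_nat_recl //.
rewrite ltNge (ltW x0) /= add0r big_add1 /=.
apply: ler_sum => n _; case: ifP => [xn|_]; last first.
  by rewrite mulr_ge0 ?powR_ge0 ?rankin_ge0.
(* For n > x one has 1/L(n) = n^(-1/3) (n^(1/3)/L(n)) <= x^(-1/3) n^(1/3)/L(n). *)
rewrite /rankin mulrAC ler_peMl //.
have -> : sixth R n.+1 ^+ 2 = n.+1%:R `^ (1 / 3).
  by rewrite -powR_mulrn ?powR_ge0 // -powRrM; congr (_ `^ _); field.
rewrite powRN ler_pdivlMr ?powR_gt0 // !mul1r.
by rewrite ge0_ler_powR ?nnegrE ?invr_ge0 // ltW.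
Qed.

End LucasSums.

Theorem proposition1p6 (R : realType) (a1 a2 : int) (u : nat -> int)
    (hu : lucas_sequence a1 a2 u)
    (hnd : nondegenerate_lucas R a1 a2)
    (hdisc : a1 ^+ 2 + 4 * a2 != 0)
    (L : nat -> nat)
    (hL : multiplicative_fun L)
    (hLndvd : forall p k : nat, prime p -> ~~ (p %| a2)%Z -> (0 < k)%N ->
       L (p ^ k)%N = ell u (p ^ k)%N)
    (hLdvd : forall p k : nat, prime p -> (p %| a2)%Z -> (0 < k)%N ->
       L (p ^ k)%N = (p ^ k)%N) :
  exists2 c : R, 0 < c &
    forall eps : R, 0 < eps ->
      exists x0 : R, forall x : R, x0 <= x ->
        (`| tail_sum L x | <= (c * x `^ (- (1 / 3) + eps))%:E)%E.
Proof.
have hnz n : (0 < n)%N -> u n != 0 by exact: (lucas_neq0 hu hnd hdisc).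
have [c c0 tail_le] := tail_sum_le R hu hdisc hnz hL hLndvd hLdvd.
exists c => // eps eps0; exists 1 => x x1.
rewrite gee0_abs; last first.
  by apply: nneseries_ge0 => n _ _; rewrite lee_fin invr_ge0.
apply: le_trans (tail_le x x1) _.
by rewrite lee_fin ler_wpM2l ?(ltW c0) // ler_powR // lerDl ltW.
Qed.
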